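(* Let $\vec u=(u_1,\dots,u_{m+n})\in[0,R]^{m+n}$ be such that $$\forall\,\vec k=(k_1,\dots,k_{m+n})\in\mathcal G_{VV}:\quad\Delta(\vec u,\vec k)=\sum_{i=1}^{m}q_i(u_i,k_i)-\sum_{j=m+1}^{m+n}q_j(u_j,k_j)\ge0.$$ Then $\vec u\in\mathcal G_{VV}$. Moreover, the conclusion $\vec u\in\mathcal G_{VV}$ still holds if in the family of inequalities ''$\sum_{i=1}^{m}q_i(u_i,k_i)-\sum_{j=m+1}^{m+n}q_j(u_j,k_j)\ge0$ for all $\vec k\in\mathcal G_{VV}$'' the condition ''$\vec k\in\mathcal G_{VV}$'' is replaced by the condition ''$\vec k\in\mathcal G_{VV}^o$'', that is, if one only assumes that $\sum_{i=1}^{m}q_i(u_i,k_i)-\sum_{j=m+1}^{m+n}q_j(u_j,k_j)\ge0$ for all $\vec k=(k_1,\dots,k_{m+n})\in\mathcal G_{VV}^o$.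
   Context: $m,n\ge1$ are integers, $R>0$; indices $i\in\{1,\dots,m\}$, $j\in\{m+1,\dots,m+n\}$, $h\in\{1,\dots,m+n\}$. For each $h$, the flux $f_h:[0,R]\to[0,+\infty)$ satisfies: (F) $f_h$ is Lipschitz with $\|f_h'\|_\infty\le L_h$, $f_h(0)=f_h(R)=0$, and there exists $\bar\rho_h\in(0,R)$ such that $f_h'(\rho)(\bar\rho_h-\rho)>0$ for a.e. $\rho\in[0,R]$; (NLD) $f_h'$ is not constant on any non-trivial subinterval of $[0,R]$. Godunov flux: $G_h(a,b)=\min_{s\in[a,b]}f_h(s)$ if $a\le b$ and $G_h(a,b)=\max_{s\in[b,a]}f_h(s)$ if $a\ge b$, for $a,b\in[0,R]$. Kruzhkov entropy flux: $q_h(u,v)=\mathrm{sign}(u-v)(f_h(u)-f_h(v))$, with $\mathrm{sign}(0)=0$. Notation: $I[a,b]=[\min\{a,b\},\max\{a,b\}]$. $\mathcal G_{VV}$ is the set of $\vec u\in[0,R]^{m+n}$ for which there exists $p\in[0,R]$ such that $\sum_{i=1}^mG_i(u_i,p)=\sum_{j=m+1}^{m+n}G_j(p,u_j)$, $G_i(u_i,p)=f_i(u_i)$ for all $i$, and $G_j(p,u_j)=f_j(u_j)$ for all $j$. $\mathcal G_{VV}^o$ is the set of $\vec k\in\mathcal G_{VV}$ for which there exists $p\in[0,R]$ such that $\sum_{i=1}^mG_i(k_i,p)=\sum_{j=m+1}^{m+n}G_j(p,k_j)$; for all $i$ and all $s\in I[k_i,p]\setminus\{k_i\}$, $(p-k_i)(f_i(s)-f_i(k_i))>0$;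 for all $j$ and all $s\in I[p,k_j]\setminus\{k_j\}$, $(k_j-p)(f_j(s)-f_j(k_j))>0$. *)

(* Defs.v *)
From HB Require Import structures.
From mathcomp Require Import all_boot all_order all_algebra.
From mathcomp Require Import all_classical all_reals all_analysis.

Set Implicit Arguments.
Unset Strict Implicit.
Unset Printing Implicit Defensive.

Import Order.TTheory GRing.Theory Num.Theory.
Import numFieldNormedType.Exports.

Local Open Scope classical_set_scope.
Local Open Scope ring_scope.

(* The reals are K : realType, and R : K is the maximal density. A flux on
   [0, R] is a function on K of which only the values on [0, R] matter.
   Roads are indexed by 'I_(m + n): the incoming ones are lshift n i
   (i : 'I_m), the outgoing ones are rshift m j (j : 'I_n). *)

(* Almost everywhere conditions on f' include the existence of f'; for a
   Lipschitz f, f' exists a.e. anyway. In the L^oo norm, f' is extended by 0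
   outside [0, R]. *)
Definition flux_F (K : realType) (R L : K) (f : K -> K) : Prop :=
  [/\ {in `[0, R], forall x, 0 <= f x},
      [lipschitz f x | x in `[0, R]],
      ('N[lebesgue_measure]_+oo[EFin \o (derive1 f \_ `[0%R, R])] <= L%:E)%E,
      f 0 = 0 /\ f R = 0
    & exists2 rhobar, rhobar \in `]0, R[ &
        {ae lebesgue_measure, forall x, x \in `[0, R] ->
          derivable f x 1 /\ 0 < derive1 f x * (rhobar - x)}].

Definition flux_NLD (K : realType) (R : K) (f : K -> K) : Prop :=
  forall a b, 0 <= a -> a < b -> b <= R ->
    ~ exists c, {ae lebesgue_measure, forall x, x \in `[a, b] ->
                  derivable f x 1 /\ derive1 f x = c}.

(* For f continuous on the interval, inf and sup are attained, hence are the
   min and the max. *)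
Definition godunov (K : realType) (f : K -> K) (a b : K) : K :=
  if a <= b then inf (f @` `[a, b]) else sup (f @` `[b, a]).

Definition kruzhkov (K : realType) (f : K -> K) (u v : K) : K :=
  Num.sg (u - v) * (f u - f v).

Section Germs.
Context (K : realType) (m n : nat) (R : K) (f : 'I_(m + n) -> K -> K).
Implicit Types (u k : 'I_(m + n) -> K) (p : K).

Local Notation inc := (lshift n).
Local Notation out := (@rshift m n).

Definition godunov_balance u p : Prop :=
  \sum_(i < m) godunov (f (inc i)) (u (inc i)) p =
  \sum_(j < n) godunov (f (out j)) p (u (out j)).

Definition germ_VV : set ('I_(m + n) -> K) :=
  [set u | (forall h, u h \in `[0, R]) /\
    exists p, [/\ p \in `[0, R],
      godunov_balance u p,
      forall i : 'I_m,
        godunov (f (inc i)) (u (inc i)) p = f (inc i) (u (inc i))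
    & forall j : 'I_n,
        godunov (f (out j)) p (u (out j)) = f (out j) (u (out j))]].

Definition germ_VVo : set ('I_(m + n) -> K) :=
  [set k | germ_VV k /\
    exists p, [/\ p \in `[0, R],
      godunov_balance k p,
      forall (i : 'I_m) (s : K),
        s \in `[Num.min (k (inc i)) p, Num.max (k (inc i)) p] ->
        s != k (inc i) ->
        0 < (p - k (inc i)) * (f (inc i) s - f (inc i) (k (inc i)))
    & forall (j : 'I_n) (s : K),
        s \in `[Num.min p (k (out j)), Num.max p (k (out j))] ->
        s != k (out j) ->
        0 < (k (out j) - p) * (f (out j) s - f (out j) (k (out j)))]].

Definition entropy_Delta u k : K :=
  \sum_(i < m) kruzhkov (f (inc i)) (u (inc i)) (k (inc i)) -
  \sum_(j < n) kruzhkov (f (out j)) (u (out j)) (k (out j)).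

End Germs.

(* Main.v *)
Require Import Defs.
From mathcomp Require Import all_boot all_order all_algebra.
From mathcomp Require Import all_classical all_reals all_analysis.
From mathcomp Require Import lra.

Set Implicit Arguments.
Unset Strict Implicit.
Unset Printing Implicit Defensive.

Import Order.TTheory GRing.Theory Num.Theory.
Import numFieldNormedType.Exports.

Local Open Scope ring_scope.

(** The vector u is compared with the solution k of the Riemann problem at the
    junction whose initial datum is u.

    Replacing f by - f on the outgoing roads turns them into incoming ones:
    the Godunov flux of - f is the opposite of that of f with its arguments
    exchanged, and the Kruzhkov flux of - f is the opposite of that of f. So
    let g_h be f_h on incoming roads and - f_h on outgoing ones. The balance of
    fluxes at p says that the sum over all h of G_h(u_h, p) vanishes, where
    G_h is the Godunov flux of g_h; and Delta(u, k) is the sum over all h of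
    the Kruzhkov fluxes of g_h at (u_h, k_h).

    A balanced p exists: as a function of p, G_h(u_h, p) is Lipschitz
    ([godunov_lipschitz]), at least g_h(0) = 0 for p = 0 and at most
    g_h(R) = 0 for p = R; the intermediate value theorem applies to the sum
    ([godunov_zero_state]).

    Given p, let k_h be the point of the interval between u_h and p which is
    closest to p among those where g_h attains the extremum defining
    G_h(u_h, p) ([riemann_trace]). Then G_h(k_h, p) = g_h(k_h) = G_h(u_h, p),
    so k is balanced by the same p, and the choice of the closest point gives
    the strict inequalities that make k an element of the smaller germ
    ([germ_VVo_riemann_trace]). Hence Delta(u, k) >= 0.

    On the other hand every Kruzhkov flux at (u_h, k_h) is nonpositive, because
    k_h is a minimum point to the right of u_h or a maximum point to its left,
    and it vanishes only if g_h(u_h) = g_h(k_h) ([kruzhkov_riemann_trace]).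
    Therefore all of them vanish, so that G_h(u_h, p) = g_h(k_h) = g_h(u_h)
    for all h, which together with the balance at p puts u in the germ. The
    assumption over the larger germ implies the one over the smaller germ, so
    this proves both assertions. *)

(** * Lipschitz functions on a segment *)

Lemma klipschitz_within_continuous (K : realType) (a b C : K) (f : K -> K) :
  C.-lipschitz_(`[a, b]%classic) f -> {within `[a, b], continuous f}%classic.
Proof.
move=> lipf; apply/subspace_continuousP => x abx; apply/cvgrPdist_le => e e0.
have C1 : 0 < `|C| + 1 by rewrite ltr_wpDl.
apply/nbhs_ballP; exists (e / (`|C| + 1)); first by rewrite /= divr_gt0.
move=> y; rewrite /ball /= ltr_pdivlMr // => xy aby.
apply: le_trans (lipf (x, y) (conj abx aby)) _ => /=.
apply: le_trans (ltW xy); rewrite [leRHS]mulrC ler_wpM2r //.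
by rewrite (le_trans (ler_norm C)) // lerDl.
Qed.

(** The minimum is attained; the supremum of the set of minimum points is
    again one, by continuity, and is the one closest to the right end point. *)
Lemma nearest_argmin (K : realType) (a p C : K) (f : K -> K) :
  a <= p -> C.-lipschitz_(`[a, p]%classic) f ->
  exists k, [/\ a <= k <= p,
    forall s, a <= s <= p -> f k <= f s &
    forall s, k < s <= p -> f k < f s].
Proof.
move=> ap lipf.
have [c cap cmin] := EVT_min ap (klipschitz_within_continuous lipf).
pose E : set K := [set s | a <= s <= p /\ f s <= f c]%classic.
have Ec : E c by move: cap; rewrite in_itv.
have ubE : ubound E p by move=> s [/andP[]].
have supE : has_sup E by split; [exists c | exists p].
have leE s : E s -> s <= sup E by apply: ub_le_sup; exists p.
have supap : a <= sup E <= p.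
  rewrite ge_sup ?andbT //; last by exists c.
  by case: (Ec) => /andP[ac _] _; exact: le_trans ac (leE _ Ec).
have fsup : f (sup E) <= f c.
  apply/ler_addgt0Pr => e e0.
  have C1 : 0 < `|C| + 1 by rewrite ltr_wpDl.
  have [s Es] := sup_adherent (divr_gt0 e0 C1) supE.
  have [sap fs] := Es.
  rewrite ltrBlDr -ltrBlDl ltr_pdivlMr // => ss.
  have /= := lipf (sup E, s); rewrite !in_itv /= => /(_ (conj supap sap)).
  rewrite ler_norml (ger0_norm (_ : 0 <= sup E - s)) ?subr_ge0 ?leE // => h.
  have Cle : C * (sup E - s) <= (sup E - s) * (`|C| + 1).
    rewrite mulrC ler_wpM2l ?subr_ge0 ?leE //.
    by rewrite (le_trans (ler_norm C)) // lerDl.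
  by move: h => /andP[_]; lra.
exists (sup E); split => //.
- by move=> s sap; apply: le_trans fsup (cmin _ _); rewrite in_itv.
- move=> s /andP[sups sp]; rewrite ltNge; apply/negP => fs.
  suff : s <= sup E by rewrite leNgt sups.
  apply: leE; split; last exact: le_trans fs fsup.
  by rewrite sp andbT; case/andP: supap => /le_trans-> //; exact: ltW.
Qed.

(** * Godunov flux and Riemann traces *)

Lemma godunov_diag (K : realType) (f : K -> K) (a : K) : godunov f a a = f a.
Proof. by rewrite /godunov lexx set_itv1 image_set1 inf1. Qed.

Lemma infN_image (K : realType) (A : set K) : inf (-%R @` A)%classic = - sup A.
Proof. by rewrite /inf setNK. Qed.

(** Reversing the direction of travel changes the sign of the flux and
    exchanges the two sides; this makes incoming roads of outgoing ones. *)
Lemma godunovN (K : realType) (f : K -> K) (a b : K) :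
  godunov (fun x => - f x) a b = - godunov f b a.
Proof.
have NK : (fun x => - - f x) = f by apply/funext => x; rewrite opprK.
wlog ab : a b f NK / a < b.
  move=> W; have [ab|ba|<-] := ltgtP a b; [exact: W| |by rewrite !godunov_diag].
  rewrite -{2}NK [X in - X]W ?opprK //.
  by apply/funext => x; rewrite opprK.
by rewrite /godunov (ltW ab) leNgt ab /= -infN_image image_comp.
Qed.

(** The factor p - a treats the minimum over [a, p] and the maximum over [p, a]
    at once; for p = a the segment is a point, and both sides are f a. *)
Lemma godunov_extremum (K : realType) (f : K -> K) (a p k : K) :
  k \in `[Num.min a p, Num.max a p] ->
  (forall s, s \in `[Num.min a p, Num.max a p] ->
     0 <= (p - a) * (f s - f k)) ->
  godunov f a p = f k.
Proof.
have [ap|pa|<-] := ltgtP a p.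
- move=> kap fmin.
  have lb : lbound (f @` `[a, p])%classic (f k).
    by move=> _ [s /fmin + <-]; rewrite pmulr_rge0 ?subr_gt0 // subr_ge0.
  have fk : (f @` `[a, p])%classic (f k) by exists k.
  rewrite /godunov (ltW ap); apply/eqP; rewrite eq_le.
  by rewrite ge_inf ?lb_le_inf //; [exists (f k)|exists (f k)].
- move=> kap fmax.
  have ub : ubound (f @` `[p, a])%classic (f k).
    by move=> _ [s /fmax + <-]; rewrite nmulr_rge0 ?subr_lt0 // subr_le0.
  have fk : (f @` `[p, a])%classic (f k) by exists k.
  rewrite /godunov leNgt pa /=; apply/eqP; rewrite eq_le.
  by rewrite ge_sup ?ub_le_sup //; [exists (f k)|exists (f k)].
- by rewrite itvxx => /eqP-> _; exact: godunov_diag.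
Qed.

(** The left trace at the interface of the self-similar solution with datum a
    on the left and state p at the interface: the extremum point defining the
    Godunov flux of (a, p) that lies closest to p. The last clause is the
    strict condition in the definition of the smaller germ. *)
Definition riemann_trace (K : realType) (f : K -> K) (a p k : K) : Prop :=
  [/\ k \in `[Num.min a p, Num.max a p],
    forall s, s \in `[Num.min a p, Num.max a p] -> 0 <= (p - a) * (f s - f k) &
    forall s, s \in `[Num.min k p, Num.max k p] -> s != k ->
      0 < (p - k) * (f s - f k)].

(** Exchanges the cases a <= p and p <= a, and with them minima and maxima. *)
Lemma riemann_trace_reflect (K : realType) (f : K -> K) (a p k : K) :
  riemann_trace (fun x => - f (- x)) (- a) (- p) k -> riemann_trace f a p (- k).
Proof.
rewrite /riemann_trace -!oppr_max -!oppr_min.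
have memN (s c d : K) : (- s \in `[- d, - c]) = (s \in `[c, d]).
  by rewrite !in_itv /= !lerN2 andbC.
rewrite -[k in k \in _]opprK memN => -[kap fext fnear]; split => //.
- by move=> s; rewrite -memN => /fext; rewrite (opprK s); nra.
- move=> s; rewrite -memN oppr_max oppr_min opprK => /fnear.
  by rewrite (opprK s) eqr_oppLR => /[apply]; nra.
Qed.

Lemma riemann_trace_exists (K : realType) (f : K -> K) (a p C : K) :
  C.-lipschitz_(`[Num.min a p, Num.max a p]%classic) f ->
  exists k, riemann_trace f a p k.
Proof.
wlog ap : f a p / a <= p.
  move=> W; case/orP: (le_total a p) => [|pa]; first exact: W.
  move=> lipf; have [||k kP] := W (fun x => - f (- x)) (- a) (- p).
  - by rewrite lerN2.
  - move=> [x y] /=; rewrite -oppr_max -oppr_min !in_itv /= => -[xap yap].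
    have /= := lipf (- x, - y); rewrite !in_itv /= => h.
    rewrite -opprD normrN (_ : x - y = - (- x - - y)) ?normrN; last by lra.
    by apply: h; split; apply/andP; split; lra.
  - by exists (- k); exact: riemann_trace_reflect.
rewrite /riemann_trace min_l // max_r // => lipf.
have [k [kap kmin knear]] := nearest_argmin ap lipf.
have [ak kp] := andP kap.
exists k; split => //.
- by move=> s; rewrite in_itv => /kmin fs; rewrite mulr_ge0 ?subr_ge0.
- move=> s; rewrite min_l // max_r // in_itv /= => /andP[ks sp] sk.
  have {}ks : k < s by rewrite lt_neqAle eq_sym sk.
  by rewrite mulr_gt0 ?subr_gt0 ?(lt_le_trans ks) // knear ?ks.
Qed.

Lemma riemann_trace_flux (K : realType) (f : K -> K) (a p k : K) :
  riemann_trace f a p k -> godunov f a p = f k.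
Proof. by case=> kap fext _; exact: godunov_extremum. Qed.

(** The solution with datum k and interface state p is at rest. *)
Lemma riemann_trace_stable (K : realType) (f : K -> K) (a p k : K) :
  riemann_trace f a p k -> godunov f k p = f k.
Proof.
case=> _ _ fnear; apply: godunov_extremum => [|s skp].
  by rewrite in_itv /= ge_min le_max lexx.
by have [->|sk] := eqVneq s k; [rewrite subrr mulr0|exact/ltW/fnear].
Qed.

Lemma riemann_trace_min (K : realType) (f : K -> K) (a p k : K) :
  riemann_trace f a p k -> a <= p ->
  a <= k <= p /\ forall s, a <= s <= p -> f k <= f s.
Proof.
move=> [kap fext _]; rewrite le_eqVlt => /orP[/eqP ap|ap].
  move: kap; rewrite ap minxx maxxx itvxx => /eqP->.
  rewrite lexx; split => // s.
  by rewrite -eq_le => /eqP->.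
move: kap fext; rewrite min_l ?max_r ?(ltW ap) // in_itv /= => kap fext.
split=> // s sap; have := fext s; rewrite in_itv => /(_ sap).
by rewrite pmulr_rge0 ?subr_gt0 // subr_ge0.
Qed.

Lemma riemann_trace_max (K : realType) (f : K -> K) (a p k : K) :
  riemann_trace f a p k -> p <= a ->
  p <= k <= a /\ forall s, p <= s <= a -> f s <= f k.
Proof.
move=> [kap fext _]; rewrite le_eqVlt => /orP[/eqP pa|pa].
  move: kap; rewrite pa minxx maxxx itvxx => /eqP->.
  rewrite lexx; split => // s.
  by rewrite -eq_le => /eqP->.
move: kap fext; rewrite min_r ?max_l ?(ltW pa) // in_itv /= => kap fext.
split=> // s sap; have := fext s; rewrite in_itv => /(_ sap).
by rewrite nmulr_rge0 ?subr_lt0 // subr_le0.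
Qed.

(** For a < k, the point k minimizes f on a segment starting at a, so that
    f a >= f k while a - k is negative; for k < a it maximizes f and both signs
    change. *)
Lemma kruzhkov_riemann_trace (K : realType) (f : K -> K) (a p k : K) :
  riemann_trace f a p k ->
  kruzhkov f a k <= 0 /\ (kruzhkov f a k = 0 -> f a = f k).
Proof.
move=> kP; rewrite /kruzhkov; case/orP: (le_total a p) => [ap|pa].
- have [/andP[+ kp] kmin] := riemann_trace_min kP ap.
  rewrite le_eqVlt => /orP[/eqP<-|ak]; first by rewrite !subrr !mulr0.
  rewrite ltr0_sg ?subr_lt0 // mulN1r oppr_le0 subr_ge0 kmin ?lexx //.
  by split=> // /eqP; rewrite oppr_eq0 subr_eq0 => /eqP.
- have [/andP[pk +] kmax] := riemann_trace_max kP pa.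
  rewrite le_eqVlt => /orP[/eqP<-|ka]; first by rewrite !subrr !mulr0.
  rewrite gtr0_sg ?subr_gt0 // mul1r subr_le0 kmax ?lexx ?andbT //.
  by split=> // /eqP; rewrite subr_eq0 => /eqP.
Qed.

Lemma sub_itv_lipschitz (K : realType) (lo hi a p C : K) (f : K -> K) :
  a \in `[lo, hi] -> p \in `[lo, hi] ->
  C.-lipschitz_(`[lo, hi]%classic) f ->
  C.-lipschitz_(`[Num.min a p, Num.max a p]%classic) f.
Proof.
rewrite !in_itv /= => /andP[la ah] /andP[lp ph] lipf [x y] [/= xap yap].
have sub z : z \in `[Num.min a p, Num.max a p] -> z \in `[lo, hi].
  rewrite !in_itv /= => /andP[mz zM]; apply/andP; split.
    by apply: le_trans mz; rewrite le_min la.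
  by apply: le_trans zM _; rewrite ge_max ah.
by apply: (lipf (x, y)); split; exact: sub.
Qed.

(** Moving p to q > p enlarges or shrinks the segment on which the extremum is
    taken by at most q - p. If a does not separate p from q, the extremum points
    k and l give nearly equal values, because one of them can be moved into the
    other segment at a distance at most q - p. If p <= a <= q, the maximum over
    [p, a] and the minimum over [a, q] are both compared with f a. In all cases
    the Godunov flux decreases. *)
Lemma godunov_lipschitz (K : realType) (lo hi a C : K) (f : K -> K) :
  0 <= C -> a \in `[lo, hi] -> C.-lipschitz_(`[lo, hi]%classic) f ->
  C.-lipschitz_(`[lo, hi]%classic) (godunov f a).
Proof.
move=> C0 aI lipf [p q] [/= pI qI].
wlog pq : p q pI qI / p <= q.
  move=> W; case/orP: (le_total p q) => [|qp]; first exact: W.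
  by rewrite distrC [`|p - q|]distrC; exact: W.
have [k kP] := riemann_trace_exists (sub_itv_lipschitz aI pI lipf).
have [l lP] := riemann_trace_exists (sub_itv_lipschitz aI qI lipf).
rewrite (riemann_trace_flux kP) (riemann_trace_flux lP).
rewrite [`|p - q|]distrC (ger0_norm (_ : 0 <= q - p)) ?subr_ge0 //.
suff [lk kl] : f l <= f k /\ f k - f l <= C * (q - p).
  by rewrite ger0_norm ?subr_ge0.
move: aI pI qI; rewrite !in_itv /=.
move=> /andP[loa ahi] /andP[lop phi] /andP[loq qhi].
have C0pq : 0 <= C * (q - p) by rewrite mulr_ge0 ?subr_ge0.
have lip x y d : lo <= x <= hi -> lo <= y <= hi -> `|x - y| <= d ->
    f x - f y <= C * d.
  move=> xI yI xyd; apply: le_trans (ler_norm _) _.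
  by apply: le_trans (lipf (x, y) _) _; rewrite /= ?in_itv // ler_wpM2l.
have [ap|pa] := ltP a p.
  have [/andP[ak kp] kmin] := riemann_trace_min kP (ltW ap).
  have [/andP[al lq] lmin] := riemann_trace_min lP (le_trans (ltW ap) pq).
  split; first by rewrite lmin // ak (le_trans kp).
  have [lp|pl] := leP l p.
    have : f k <= f l by rewrite kmin ?al.
    by lra.
  (* l has left [a, p], where k is optimal; p is the nearest point of it. *)
  have kfp : f k <= f p by rewrite kmin // lexx ltW.
  have : f p - f l <= C * (q - p) by apply: lip; rewrite ?ler_norml; lra.
  by lra.
have [qa|aq] := ltP q a.
  have [/andP[pk ka] kmax] := riemann_trace_max kP pa.
  have [/andP[ql la] lmax] := riemann_trace_max lP (ltW qa).
  split; first by rewrite kmax // la (le_trans pq).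
  have [qk|kq] := leP q k.
    have : f k <= f l by rewrite lmax ?qk.
    by lra.
  (* k lies outside [q, a], where l is optimal; q is the nearest point of it. *)
  have lfq : f q <= f l by rewrite lmax // lexx ltW.
  have : f k - f q <= C * (q - p) by apply: lip; rewrite ?ler_norml; lra.
  by lra.
have [/andP[pk ka] kmax] := riemann_trace_max kP pa.
have [/andP[al lq] lmin] := riemann_trace_min lP aq.
have fak : f a <= f k by rewrite kmax ?pa ?lexx.
have fla : f l <= f a by rewrite lmin ?aq ?lexx.
split; first exact: le_trans fak.
by apply: lip; rewrite ?ler_norml; lra.
Qed.

(** At p = lo all Godunov fluxes are maxima over segments containing lo, hence
    nonnegative; at p = hi they are minima over segments containing hi. *)
Lemma godunov_zero_state (K : realType) (lo hi C : K) (I : finType)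
    (g : I -> K -> K) (a : I -> K) :
  lo <= hi -> 0 <= C -> (forall h, a h \in `[lo, hi]) ->
  (forall h, C.-lipschitz_(`[lo, hi]%classic) (g h)) ->
  (forall h, 0 <= g h lo) -> (forall h, g h hi <= 0) ->
  exists2 p, p \in `[lo, hi] & \sum_h godunov (g h) (a h) p = 0.
Proof.
move=> lohi C0 aI lipg g_lo g_hi.
pose H p := \sum_h godunov (g h) (a h) p.
have lipH : (\sum_(h : I) C).-lipschitz_(`[lo, hi]%classic) H.
  move=> [p q] pqI; rewrite /H /= -sumrB mulr_suml.
  apply: le_trans (ler_norm_sum _ _ _) _; apply: ler_sum => h _.
  exact: (godunov_lipschitz C0 (aI h) (lipg h) pqI).
have traceH h p : p \in `[lo, hi] -> exists k, riemann_trace (g h) (a h) p k.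
  move=> pI.
  exact: (riemann_trace_exists (sub_itv_lipschitz (aI h) pI (lipg h))).
have Hlo : 0 <= H lo.
  apply: sumr_ge0 => h _.
  have [|k kP] := traceH h lo; first by rewrite in_itv /= lexx.
  have := aI h; rewrite in_itv /= (riemann_trace_flux kP) => /andP[la _].
  have [_ kmax] := riemann_trace_max kP la.
  by rewrite (le_trans (g_lo h)) ?kmax ?lexx.
have Hhi : H hi <= 0.
  apply: sumr_le0 => h _.
  have [|k kP] := traceH h hi; first by rewrite in_itv /= lexx lohi.
  have := aI h; rewrite in_itv /= (riemann_trace_flux kP) => /andP[_ ah].
  have [_ kmin] := riemann_trace_min kP ah.
  by rewrite (le_trans _ (g_hi h)) ?kmin ?lexx ?ah.
apply: IVT lohi (klipschitz_within_continuous lipH) _.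
by rewrite ge_min le_max Hlo Hhi orbT.
Qed.

(** * Junctions with all roads incoming *)

Definition inward_flux (K : realType) (m n : nat) (f : 'I_(m + n) -> K -> K)
    (h : 'I_(m + n)) : K -> K :=
  if (h < m)%N then f h else fun x => - f h x.

Lemma inward_flux_inc (K : realType) (m n : nat) (f : 'I_(m + n) -> K -> K)
    (i : 'I_m) : inward_flux f (lshift n i) = f (lshift n i).
Proof. by rewrite /inward_flux /= ltn_ord. Qed.

Lemma inward_flux_out (K : realType) (m n : nat) (f : 'I_(m + n) -> K -> K)
    (j : 'I_n) : inward_flux f (rshift m j) = fun x => - f (rshift m j) x.
Proof. by rewrite /inward_flux /= ltnNge leq_addr. Qed.

Lemma godunov_balanceE (K : realType) (m n : nat) (f : 'I_(m + n) -> K -> K)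
    (u : 'I_(m + n) -> K) (p : K) :
  godunov_balance f u p <-> \sum_h godunov (inward_flux f h) (u h) p = 0.
Proof.
rewrite /godunov_balance big_split_ord /=.
under [X in _ <-> X + _ = _]eq_bigr do rewrite inward_flux_inc.
under [X in _ <-> _ + X = _]eq_bigr do rewrite inward_flux_out godunovN.
by rewrite sumrN; split=> /eqP; [rewrite -subr_eq0|rewrite subr_eq0] => /eqP.
Qed.

Lemma entropy_DeltaE (K : realType) (m n : nat) (f : 'I_(m + n) -> K -> K)
    (u k : 'I_(m + n) -> K) :
  entropy_Delta f u k = \sum_h kruzhkov (inward_flux f h) (u h) (k h).
Proof.
rewrite /entropy_Delta big_split_ord /= -sumrN; congr (_ + _).
  by apply: eq_bigr => i _; rewrite inward_flux_inc.
apply: eq_bigr => j _; rewrite inward_flux_out /kruzhkov.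
by rewrite -mulrN opprD.
Qed.

Lemma germ_VV_inward_flux (K : realType) (m n : nat) (R : K)
    (f : 'I_(m + n) -> K -> K) (u : 'I_(m + n) -> K) (p : K) :
  (forall h, u h \in `[0, R]) -> p \in `[0, R] ->
  \sum_h godunov (inward_flux f h) (u h) p = 0 ->
  (forall h, godunov (inward_flux f h) (u h) p = inward_flux f h (u h)) ->
  germ_VV R f u.
Proof.
move=> uI pI bal Gu; split=> //; exists p; split=> //.
- exact/godunov_balanceE.
- by move=> i; rewrite -inward_flux_inc.
- move=> j; apply: oppr_inj.
  by rewrite -godunovN -inward_flux_out Gu inward_flux_out.
Qed.

(** Solving the Riemann problem at the junction with datum u yields a
    stationary state of the smaller germ. *)
Lemma germ_VVo_riemann_trace (K : realType) (m n : nat) (R : K)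
    (f : 'I_(m + n) -> K -> K) (u k : 'I_(m + n) -> K) (p : K) :
  (forall h, u h \in `[0, R]) -> p \in `[0, R] ->
  \sum_h godunov (inward_flux f h) (u h) p = 0 ->
  (forall h, riemann_trace (inward_flux f h) (u h) p (k h)) ->
  germ_VVo R f k.
Proof.
move=> uI pI bal kP.
have kI h : k h \in `[0, R].
  have [+ _ _] := kP h; have := uI h; move: pI; rewrite !in_itv /=.
  rewrite ge_min le_max => /andP[p0 pR] /andP[u0 uR] /andP[mk kM].
  by case/orP: mk; case/orP: kM; lra.
have balk : \sum_h godunov (inward_flux f h) (k h) p = 0.
  apply: etrans bal; apply: eq_bigr => h _.
  by rewrite (riemann_trace_stable (kP h)) (riemann_trace_flux (kP h)).
split.
  apply: germ_VV_inward_flux balk _ => // h.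
  exact: riemann_trace_stable (kP h).
exists p; split=> //; first exact/godunov_balanceE.
- move=> i s sI sk.
  by have [_ _] := kP (lshift n i); rewrite inward_flux_inc; exact.
- move=> j s; rewrite minC maxC => sI sk.
  have [_ _] := kP (rshift m j); rewrite inward_flux_out => /(_ s sI sk).
  by nra.
Qed.

(** A common constant for all roads exists as they are finitely many. *)
Lemma lipschitz_inward_flux (K : realType) (m n : nat) (R : K)
    (f : 'I_(m + n) -> K -> K) :
  (forall h, [lipschitz f h x | x in `[0, R]%classic]) ->
  exists2 C, 0 <= C &
    forall h, C.-lipschitz_(`[0, R]%classic) (inward_flux f h).
Proof.
move=> lipf.
have [C [C0 lipC]] : exists C : K, 0 <= C /\
    forall h, C.-lipschitz_(`[0, R]%classic) (f h).
  have near_lip : \forall C \near +oo,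
      forall h, C.-lipschitz_(`[0, R]%classic) (f h).
    exact: filter_forall.
  near (pinfty_nbhs K) => C; exists C; split; last by near: C.
  by near: C; exact: nbhs_pinfty_ge.
exists C => // h [x y] xyI; rewrite /inward_flux; case: ifP => _.
  exact: (lipC h (x, y)).
by rewrite /= -opprD normrN; exact: (lipC h (x, y)).
Unshelve. all: by end_near. Qed.

(** * The germ is characterized by the entropy inequalities *)

Theorem lemma2p8 (K : realType) (m n : nat) (hm : (1 <= m)%N) (hn : (1 <= n)%N)
  (R : K) (hR : 0 < R) (L : 'I_(m + n) -> K) (f : 'I_(m + n) -> K -> K)
  (hF : forall h, flux_F R (L h) (f h))
  (hNLD : forall h, flux_NLD R (f h))
  (u : 'I_(m + n) -> K) (hu : forall h, u h \in `[0, R]) :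
  ((forall k, germ_VV R f k -> 0 <= entropy_Delta f u k) -> germ_VV R f u) /\
  ((forall k, germ_VVo R f k -> 0 <= entropy_Delta f u k) -> germ_VV R f u).
Proof.
suff VVo : (forall k, germ_VVo R f k -> 0 <= entropy_Delta f u k) ->
    germ_VV R f u.
  by split=> // VV; apply: VVo => k [/VV].
move=> entropy.
have [C C0 lipC] : exists2 C, 0 <= C &
    forall h, C.-lipschitz_(`[0, R]%classic) (inward_flux f h).
  by apply: lipschitz_inward_flux => h; have [] := hF h.
have f0R h : inward_flux f h 0 = 0 /\ inward_flux f h R = 0.
  have [_ _ _ [f0 fR] _] := hF h; rewrite /inward_flux.
  by case: ifP; rewrite f0 fR ?oppr0.
have [p pI bal] : exists2 p, p \in `[0, R] &
    \sum_h godunov (inward_flux f h) (u h) p = 0.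
  apply: godunov_zero_state C0 hu lipC _ _ => [|h|h]; first exact: ltW.
    by rewrite (f0R h).1.
  by rewrite (f0R h).2.
have /choice[k kP] h : exists k, riemann_trace (inward_flux f h) (u h) p k.
  exact: riemann_trace_exists (sub_itv_lipschitz (hu h) pI (lipC h)).
have /entropy := germ_VVo_riemann_trace hu pI bal kP.
rewrite entropy_DeltaE => Delta_ge0.
have q_le0 h := (kruzhkov_riemann_trace (kP h)).1.
have /psumr_eq0P q0 : \sum_h - kruzhkov (inward_flux f h) (u h) (k h) = 0.
  apply/eqP; rewrite eq_le sumrN oppr_le0 Delta_ge0 oppr_ge0.
  by apply: sumr_le0 => h _.
apply: germ_VV_inward_flux bal _ => // h; rewrite (riemann_trace_flux (kP h)).
apply/esym/(kruzhkov_riemann_trace (kP h)).2/oppr_inj; rewrite oppr0.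
by apply: q0 => // h' _; rewrite oppr_ge0.
Qed.
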